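(* Let $X$ be a coalgebra over a field $k$ and let $s\colon X\otimes X\to X\otimes X$ be a left non-degenerate coalgebra endomorphism. Let $x\cdot y:=(X\otimes\epsilon)\circ G_s^{-1}(x\otimes y)$ and $x\mathbin{:}y:={}^{y\cdot x_{(1)}}x_{(2)}$ be the two binary operations on $X$ associated with $s$. Then the triple $\mathcal{X}=(X,\cdot,\mathbin{:})$ is a left regular $q$-magma coalgebra.
   Context: All vector spaces, maps and tensor products are over $k$ (maps are linear); $\Delta,\epsilon$ are the comultiplication and counit; Sweedler notation $\Delta(x)=x_{(1)}\otimes x_{(2)}$ is used (summation omitted); $X^2=X\otimes X$; $X^{\mathrm{cop}}$ is the opposite coalgebra. $X$ inside a tensor product of maps denotes $\mathrm{id}_X$. Coalgebra endomorphisms: for $s\colon X^2\to X^2$ put ${}^xy:=(X\otimes\epsilon)s(x\otimes y)$ and $x^y:=(\epsilon\otimes X)s(x\otimes y)$, and let $G_s\colon X^2\to X^2$ be $G_s(x\otimes y):=x^{y_{(1)}}\otimes y_{(2)}$. A coalgebra morphism $s$ is left non-degenerate if $G_s$ is invertible. $q$-magma coalgebras: let $x\otimes y\mapsto x\cdot y$ and $x\otimes y\mapsto x\mathbin{:}y$ be linear maps $X^2\to X$ with $\epsilon(x\cdot y)=\epsilon(x\mathbin{:}y)=\epsilon(x)\epsilon(y)$. The triple $(X,\cdot,\mathbin{:})$ is a $q$-magma coalgebra if $h\colon X\otimes X^{\mathrm{cop}}\to X^{\mathrm{cop}}\otimes X$, $h(x\otimes y):=y_{(1)}\mathbin{:}x_{(2)}\otimes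 x_{(1)}\cdot y_{(2)}$, is a coalgebra morphism. It is left regular if the map $x\otimes y\mapsto x\cdot y_{(1)}\otimes y_{(2)}$ from $X^2$ to $X^2$ is invertible. *)

(* Defs.v *)
From HB Require Import structures.
From mathcomp Require Import all_boot all_algebra.
From mathcomp Require Import boolp.
From mathcomp Require Import freeg.

Set Implicit Arguments.
Unset Strict Implicit.
Unset Printing Implicit Defensive.

Import GRing.Theory.
Local Open Scope ring_scope.
Local Open Scope quotient_scope.

Reserved Notation "V ⊗ W" (at level 40, left associativity).
Reserved Notation "v ⊗ₜ w" (at level 40, left associativity).

Section TensorProduct.
Context {k : fieldType}.

Definition bilin (V W U : lmodType k) (f : V -> W -> U) : Prop :=
  (forall w, linear (f^~ w)) /\ (forall v, linear (f v)).

(* MathComp has no tensor product of arbitrary vector spaces: it is specified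
   here by its universal property (uniqueness of the factorization, lemma
   [tensor_ext], follows from [tp_ind]) and constructed in [tensor_product_of]. *)
Record tensor_product (V W : lmodType k) := TensorProduct {
  tp_space : lmodType k;
  tp_pure : V -> W -> tp_space;
  tp_bilin : bilin tp_pure;
  tp_lift (U : lmodType k) (f : V -> W -> U) :
    bilin f -> {linear tp_space -> U};
  tp_liftE (U : lmodType k) (f : V -> W -> U) (fbil : bilin f) v w :
    tp_lift fbil (tp_pure v w) = f v w;
  tp_ind (P : tp_space -> Prop) :
    P 0 -> (forall t u, P t -> P u -> P (t + u)) ->
    (forall v w, P (tp_pure v w)) -> forall t, P t
}.

End TensorProduct.

Lemma fglift_is_linear (R : nzRingType) (K : choiceType) (M : lmodType R)
  (f : K -> M) : linear (@fglift R M K f).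
Proof.
have fB := @lift_is_additive R K M f.
pose g : {additive {freeg K / R} -> M} :=
  HB.pack (fglift f) (GRing.isZmodMorphism.Build _ _ (fglift f) fB).
have gZ a D : g (a *: D) = a *: g D.
  have -> : a *: D = \sum_(x <- dom D) << a * coeff x D *g x >> by [].
  rewrite -[in RHS](freeg_sumE D) !raddf_sum /=.
  by apply: eq_bigr => i _; rewrite !liftU scalerA.
by move=> a D E; rewrite -[fglift f]/(g : _ -> _) raddfD gZ.
Qed.

HB.instance Definition _ (R : nzRingType) (K : choiceType) (M : lmodType R)
  (f : K -> M) := GRing.isLinear.Build R {freeg K / R} M _ (@fglift R M K f)
    (fglift_is_linear f).

(* The construction: the free vector space on V * W modulo the subspace spanned
   by (a v + v', w) - a (v, w) - (v', w) and (v, a w + w') - a (v, w) - (v, w'). *)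
Section TensorConstruction.
Context {k : fieldType} (V W : lmodType k).

Local Notation F := {freeg (V * W)%type / k}.

Inductive tensor_rel : F -> Prop :=
| TensorRel0 : tensor_rel 0
| TensorRelB D E : tensor_rel D -> tensor_rel E -> tensor_rel (D - E)
| TensorRelZ a D : tensor_rel D -> tensor_rel (a *: D)
| TensorRelL a v v' w :
    tensor_rel (<< (a *: v + v', w) >> - a *: << (v, w) >> - << (v', w) >>)
| TensorRelR a v w w' :
    tensor_rel (<< (v, a *: w + w') >> - a *: << (v, w) >> - << (v, w') >>).

Definition tensor_relb : {pred F} := fun D => `[< tensor_rel D >].

Lemma tensor_relb_closed : zmod_closed tensor_relb.
Proof.
split=> [|D E]; first exact/asboolP/TensorRel0.
by move=> /asboolP ? /asboolP ?; apply/asboolP/TensorRelB.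
Qed.

HB.instance Definition _ := GRing.isZmodClosed.Build F tensor_relb
  tensor_relb_closed.

Definition tensor_quot := Quotient.quot tensor_relb.

HB.instance Definition _ := GRing.Zmodule.on tensor_quot.

Definition tpi (D : F) : tensor_quot := \pi_(Quotient.quot tensor_relb) D.

Lemma tpiB : zmod_morphism tpi.
Proof. by move=> D E; rewrite /tpi !piE. Qed.

HB.instance Definition _ := GRing.isZmodMorphism.Build F tensor_quot tpi tpiB.

Lemma tpi_eq D E : tensor_rel (D - E) -> tpi D = tpi E.
Proof. by move=> h; apply/eqP; rewrite /tpi piE; apply/asboolP. Qed.

Lemma tpi_eqP D E : tpi D = tpi E -> tensor_rel (D - E).
Proof. by move/eqP; rewrite /tpi piE => /asboolP. Qed.

Lemma tpiK (t : tensor_quot) : tpi (repr t) = t.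
Proof. exact: reprK. Qed.

Definition tscale (a : k) (t : tensor_quot) : tensor_quot := tpi (a *: repr t).

Lemma tscale_pi a D : tscale a (tpi D) = tpi (a *: D).
Proof.
by apply: tpi_eq; rewrite -scalerBr; apply/TensorRelZ/tpi_eqP; rewrite tpiK.
Qed.

Lemma tscaleA a b t : tscale a (tscale b t) = tscale (a * b) t.
Proof. by rewrite -[t]tpiK !tscale_pi scalerA. Qed.
Lemma tscale1 : left_id 1 tscale.
Proof. by move=> t; rewrite -[t]tpiK tscale_pi scale1r. Qed.
Lemma tscaleDr : right_distributive tscale +%R.
Proof.
move=> a t u; rewrite -[t]tpiK -[u]tpiK -raddfD !tscale_pi -raddfD.
by rewrite scalerDr.
Qed.
Lemma tscaleDl t : {morph tscale^~ t : a b / a + b}.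
Proof. by move=> a b; rewrite -[t]tpiK !tscale_pi -raddfD scalerDl. Qed.

HB.instance Definition _ := GRing.Zmodule_isLmodule.Build k tensor_quot
  tscaleA tscale1 tscaleDr tscaleDl.

Definition qpure (v : V) (w : W) : tensor_quot := tpi << (v, w) >>.

Lemma tpiZ a D : tpi (a *: D) = a *: tpi D.
Proof. by rewrite -tscale_pi. Qed.

Lemma qpure_bilin : bilin qpure.
Proof.
split=> [w a v v'|v a w w']; rewrite /qpure -tpiZ -raddfD; apply: tpi_eq;
  rewrite opprD addrA; [exact: TensorRelL | exact: TensorRelR].
Qed.

Lemma tquot_ind (P : tensor_quot -> Prop) :
    P 0 -> (forall t u, P t -> P u -> P (t + u)) ->
    (forall v w, P (qpure v w)) -> forall t, P t.
Proof.
move=> P0 PD Pp t; rewrite -[t]tpiK -[repr t]freeg_sumE raddf_sum.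
apply: (big_ind P) => // -[v w] _; set c := coeff _ _.
have -> : << c *g (v, w) >> = c *: << (v, w) >> :> F.
  by apply/eqP/freeg_eqP => x; rewrite coeffZ !coeffU mul1r.
have pl := qpure_bilin.1 w.
have p0 : qpure 0 w = 0.
  by have := pl (-1) 0 0; rewrite scaler0 addr0 scaleN1r addNr.
have e : tpi (c *: << (v, w) >>) = qpure (c *: v) w;
  last by move: (Pp (c *: v) w); rewrite -e.
by rewrite tpiZ -[c *: v]addr0 pl p0 addr0.
Qed.

Section Lift.
Context (U : lmodType k) (f : V -> W -> U) (fbil : bilin f).

Let f0 (vw : V * W) : U := f vw.1 vw.2.

Definition qlift of bilin f := fun t : tensor_quot => fglift f0 (repr t).

Lemma qlift_rel D : tensor_rel D -> fglift f0 D = 0.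
Proof.
elim=> [|{}D E _ hD _ hE|a {}D _ hD|a v v' w|a v w w'].
- by rewrite linear0.
- by rewrite linearB /= hD hE subr0.
- by rewrite linearZ /= hD scaler0.
- by rewrite !linearB linearZ /= !liftU !scale1r /f0 /= fbil.1 addrAC addrK subrr.
- by rewrite !linearB linearZ /= !liftU !scale1r /f0 /= fbil.2 addrAC addrK subrr.
Qed.

Lemma qlift_pi D : qlift fbil (tpi D) = fglift f0 D.
Proof.
apply/eqP; rewrite -subr_eq0 -linearB; apply/eqP/qlift_rel/tpi_eqP.
exact: tpiK.
Qed.

Lemma qlift_is_linear : linear (qlift fbil).
Proof.
by move=> a t u; rewrite -[t]tpiK -[u]tpiK -tpiZ -raddfD !qlift_pi linearP.
Qed.

HB.instance Definition _ := GRing.isLinear.Build k tensor_quot U _ (qlift fbil)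
  qlift_is_linear.

Lemma qliftE v w : qlift fbil (qpure v w) = f v w.
Proof. by rewrite qlift_pi liftU scale1r. Qed.

End Lift.

(* Opaque: only the universal property can be used. *)
Definition tensor_product_of : tensor_product V W.
Proof.
exact: (@TensorProduct k V W tensor_quot qpure qpure_bilin
  (fun U f fbil => qlift fbil) (fun U f fbil => @qliftE U f fbil) tquot_ind).
Qed.

End TensorConstruction.

Section Tensor.
Context {k : fieldType} (V W : lmodType k).

Definition tensor : lmodType k := tp_space (tensor_product_of V W).

Definition pure : V -> W -> tensor := @tp_pure k V W _.

Definition tlift (U : lmodType k) (f : V -> W -> U) (fbil : bilin f) :
  {linear tensor -> U} := tp_lift _ fbil.

Lemma pure_bilin : bilin pure.
Proof. exact: tp_bilin. Qed.

Lemma tliftE (U : lmodType k) (f : V -> W -> U) (fbil : bilin f) v w :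
  tlift fbil (pure v w) = f v w.
Proof. exact: tp_liftE. Qed.

Lemma tensor_ind (P : tensor -> Prop) :
  P 0 -> (forall t u, P t -> P u -> P (t + u)) ->
  (forall v w, P (pure v w)) -> forall t, P t.
Proof. exact: tp_ind. Qed.

Lemma tensor_ext (U : lmodType k) (f g : {linear tensor -> U}) :
  (forall v w, f (pure v w) = g (pure v w)) -> f =1 g.
Proof.
move=> fg; apply: tensor_ind => [|t u ht hu|v w]; first by rewrite !linear0.
  by rewrite !linearD ht hu.
exact: fg.
Qed.

End Tensor.

Notation "V ⊗ W" := (tensor V W) : type_scope.
Notation "v ⊗ₜ w" := (pure v w) : ring_scope.

Section TensorMaps.
Context {k : fieldType}.
Implicit Types A B C D U V W : lmodType k.

Lemma pure_linl V W (w : W) : linear (fun v : V => v ⊗ₜ w).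
Proof. exact: (pure_bilin V W).1. Qed.

Lemma pure_linr V W (v : V) : linear (@pure k V W v).
Proof. exact: (pure_bilin V W).2. Qed.

Lemma pure0l V W (w : W) : (0 : V) ⊗ₜ w = 0.
Proof.
by have := pure_linl w (-1) (0 : V) 0; rewrite scaler0 addr0 scaleN1r addNr.
Qed.

Lemma pureDl V W (v v' : V) (w : W) : (v + v') ⊗ₜ w = v ⊗ₜ w + v' ⊗ₜ w.
Proof. by have := pure_linl w 1 v v'; rewrite !scale1r. Qed.

HB.instance Definition _ V W (v : V) :=
  GRing.isLinear.Build k W (V ⊗ W) _ (@pure k V W v) (pure_linr v).

Definition idl V : {linear V -> V} := idfun.
Arguments idl : simpl never.

Lemma idlE V (v : V) : idl V v = v.
Proof. by []. Qed.

Lemma tmap_bilin V V' W W' (f : {linear V -> V'}) (g : {linear W -> W'}) :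
  bilin (fun v w => f v ⊗ₜ g w).
Proof.
by split=> [w a v v'|v a w w']; rewrite linearP ?pure_linl ?pure_linr.
Qed.

Definition tmap V V' W W' (f : {linear V -> V'}) (g : {linear W -> W'}) :
  {linear V ⊗ W -> V' ⊗ W'} := tlift (tmap_bilin f g).
Arguments tmap : simpl never.

Lemma tmapE V V' W W' (f : {linear V -> V'}) (g : {linear W -> W'}) v w :
  tmap f g (v ⊗ₜ w) = f v ⊗ₜ g w.
Proof. exact: tliftE. Qed.

Lemma tswap_bilin V W : bilin (fun (v : V) (w : W) => w ⊗ₜ v).
Proof. by split=> [w a v v'|v a w w']; rewrite ?pure_linl ?pure_linr. Qed.

Definition tswap V W : {linear V ⊗ W -> W ⊗ V} := tlift (@tswap_bilin V W).
Arguments tswap : simpl never.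

Lemma tswapE V W (v : V) (w : W) : tswap V W (v ⊗ₜ w) = w ⊗ₜ v.
Proof. exact: tliftE. Qed.

Lemma tassoc_bilin U V W :
  bilin (fun (u : U) (t : V ⊗ W) => tmap (@pure k U V u) (idl W) t).
Proof.
split=> [t a u u'|u a t t']; last by rewrite linearP.
move: t; apply: tensor_ind => [|t1 t2 h1 h2|v w].
- by rewrite !linear0 ?scaler0 addr0.
- by rewrite !linearD h1 h2 ?scalerDr addrACA.
by rewrite !tmapE /= !pure_linl.
Qed.

Definition tassoc U V W : {linear U ⊗ (V ⊗ W) -> (U ⊗ V) ⊗ W} :=
  tlift (@tassoc_bilin U V W).
Arguments tassoc : simpl never.

Lemma tassocE U V W (u : U) (v : V) (w : W) :
  tassoc U V W (u ⊗ₜ (v ⊗ₜ w)) = (u ⊗ₜ v) ⊗ₜ w.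
Proof. by rewrite [LHS]tliftE tmapE. Qed.

Lemma trid_bilin V : bilin (fun (v : V) (a : k^o) => (a : k) *: v).
Proof.
split=> [b a v v'|v a b b']; last by rewrite scalerDl scalerA.
by rewrite scalerDr !scalerA mulrC.
Qed.

Definition trid V : {linear V ⊗ k^o -> V} := tlift (@trid_bilin V).
Arguments trid : simpl never.

Lemma tridE V (v : V) (a : k^o) : trid V (v ⊗ₜ a) = (a : k) *: v.
Proof. exact: tliftE. Qed.

Definition tlid V : {linear k^o ⊗ V -> V} := trid V \o tswap k^o V.

Lemma tlidE V (v : V) (a : k^o) : tlid V (a ⊗ₜ v) = (a : k) *: v.
Proof. by rewrite /= tswapE tridE. Qed.

Lemma tmid_bilin0 A B C D (u : C ⊗ D) :
  bilin (fun (a : A) (b : B) => tmap (@pure k A C a) (@pure k B D b) u).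
Proof.
split=> [b c a a'|a c b b']; move: u; apply: tensor_ind => [|t1 t2 h1 h2|v w];
  rewrite ?linear0 ?scaler0 ?addr0 // ?linearD ?h1 ?h2 ?scalerDr 1?addrACA //.
- by rewrite !tmapE /= !pure_linl.
- by rewrite !tmapE /= pure_linl pure_linr.
Qed.

Lemma tmid_bilin A B C D : bilin (fun (t : A ⊗ B) (u : C ⊗ D) =>
  tlift (@tmid_bilin0 A B C D u) t).
Proof.
split=> [u a t t'|t a u u']; first by rewrite linearP.
move: t; apply: tensor_ind => [|t1 t2 h1 h2|v w].
- by rewrite !linear0 ?scaler0 addr0.
- by rewrite !linearD /= h1 h2 ?scalerDr addrACA.
by rewrite !tliftE linearP.
Qed.

Definition tmid A B C D :
    {linear (A ⊗ B) ⊗ (C ⊗ D) -> (A ⊗ C) ⊗ (B ⊗ D)} :=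
  tlift (@tmid_bilin A B C D).
Arguments tmid : simpl never.

Lemma tmidE A B C D (a : A) (b : B) (c : C) (d : D) :
  tmid A B C D ((a ⊗ₜ b) ⊗ₜ (c ⊗ₜ d)) = (a ⊗ₜ c) ⊗ₜ (b ⊗ₜ d).
Proof. by rewrite [LHS]tliftE tliftE tmapE. Qed.

Section Inverse.
Context (V W : lmodType k) (f : {linear V -> W}).

Lemma linv_ex : bijective f -> forall w, exists v, f v == w.
Proof. by case=> g _ fK w; exists (g w); rewrite fK. Qed.

Definition linv (fbij : bijective f) (w : W) : V := xchoose (linv_ex fbij w).

Context (fbij : bijective f).

Lemma linvK : cancel (linv fbij) f.
Proof. by move=> w; apply/eqP/(xchooseP (linv_ex fbij w)). Qed.

Lemma linvK' : cancel f (linv fbij).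
Proof. by move=> v; apply: (bij_inj fbij); rewrite linvK. Qed.

Lemma linv_is_linear : linear (linv fbij).
Proof. by move=> a u v; apply: (bij_inj fbij); rewrite linearP !linvK. Qed.

HB.instance Definition _ := GRing.isLinear.Build k W V _ (linv fbij)
  linv_is_linear.

End Inverse.
End TensorMaps.

Record coalgebra (k : fieldType) := Coalgebra {
  coalg_sort :> lmodType k;
  comul : {linear coalg_sort -> coalg_sort ⊗ coalg_sort};
  counit : {linear coalg_sort -> k^o};
  comulA : forall x, tmap comul (idl coalg_sort) (comul x) =
    tassoc coalg_sort coalg_sort coalg_sort
      (tmap (idl coalg_sort) comul (comul x));
  counitl : forall x, tlid coalg_sort
    (tmap counit (idl coalg_sort) (comul x)) = x;
  counitr : forall x, trid coalg_sort
    (tmap (idl coalg_sort) counit (comul x)) = x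
}.

Arguments comul {k} c.
Arguments counit {k} c.

Section Coalgebras.
Context {k : fieldType}.
Implicit Types C D X : coalgebra k.

Definition coalgebra_morphism C D (f : {linear C -> D}) : Prop :=
  (forall x, comul D (f x) = tmap f f (comul C x)) /\
  (forall x, counit D (f x) = counit C x).

Section Cop.
Context (C : coalgebra k).

Definition cop_comul : {linear C -> C ⊗ C} := tswap C C \o comul C.

Let rev : {linear (C ⊗ C) ⊗ C -> (C ⊗ C) ⊗ C} :=
  tassoc C C C \o (tswap (C ⊗ C) C \o tmap (tswap C C) (idl C)).

Let revE (a b c : C) : rev ((a ⊗ₜ b) ⊗ₜ c) = (c ⊗ₜ b) ⊗ₜ a.
Proof. by rewrite /= tmapE tswapE /= tswapE tassocE. Qed.

Let cop_comul_revl (t : C ⊗ C) : tmap cop_comul (idl C) (tswap C C t) =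
  rev (tassoc C C C (tmap (idl C) (comul C) t)).
Proof.
move: t; apply: tensor_ind => [|t u ht hu|a b]; first by rewrite !linear0.
  by rewrite !linearD ht hu.
rewrite tswapE !tmapE [cop_comul _]/=.
move: (comul C b); apply: tensor_ind => [|t u ht hu|c d].
- by rewrite !(linear0, pure0l).
- by rewrite !(linearD, pureDl) ht hu.
by rewrite tassocE revE tswapE.
Qed.

Let cop_comul_revr (t : C ⊗ C) :
  tassoc C C C (tmap (idl C) cop_comul (tswap C C t)) =
  rev (tmap (comul C) (idl C) t).
Proof.
move: t; apply: tensor_ind => [|t u ht hu|a b]; first by rewrite !linear0.
  by rewrite !linearD ht hu.
rewrite tswapE !tmapE [cop_comul _]/=.
move: (comul C a); apply: tensor_ind => [|t u ht hu|c d].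
- by rewrite !(linear0, pure0l).
- by rewrite !(linearD, pureDl) ht hu.
by rewrite revE tswapE tassocE.
Qed.

Lemma cop_comulA x : tmap cop_comul (idl C) (cop_comul x) =
  tassoc C C C (tmap (idl C) cop_comul (cop_comul x)).
Proof. by rewrite [cop_comul x]/= cop_comul_revl cop_comul_revr comulA. Qed.

Lemma cop_counitl x : tlid C (tmap (counit C) (idl C) (cop_comul x)) = x.
Proof.
rewrite -[RHS]counitr [cop_comul x]/=.
move: (comul C x); apply: tensor_ind => [|t u ht hu|a b].
- by rewrite !linear0.
- by rewrite !linearD ht hu.
by rewrite tswapE !tmapE tlidE tridE.
Qed.

Lemma cop_counitr x : trid C (tmap (idl C) (counit C) (cop_comul x)) = x.
Proof.
rewrite -[RHS]counitl [cop_comul x]/=.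
move: (comul C x); apply: tensor_ind => [|t u ht hu|a b].
- by rewrite !linear0.
- by rewrite !linearD ht hu.
by rewrite tswapE !tmapE tlidE tridE.
Qed.

Definition cop : coalgebra k := Coalgebra cop_comulA cop_counitl cop_counitr.

End Cop.

Section TensorCoalgebra.
Context (C D : coalgebra k).

Definition tensor_comul : {linear C ⊗ D -> (C ⊗ D) ⊗ (C ⊗ D)} :=
  tmid C C D D \o tmap (comul C) (comul D).

Definition tensor_counit : {linear C ⊗ D -> k^o} :=
  trid k^o \o tmap (counit C) (counit D).

Lemma tensor_comulE (x : C) (y : D) :
  tensor_comul (x ⊗ₜ y) = tmid C C D D (comul C x ⊗ₜ comul D y).
Proof. by rewrite /= tmapE. Qed.

Lemma tensor_counitE (x : C) (y : D) :
  tensor_counit (x ⊗ₜ y) = counit C x * counit D y.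
Proof. by rewrite /= tmapE tridE mulrC. Qed.

Let mid3 : {linear ((C ⊗ C) ⊗ C) ⊗ ((D ⊗ D) ⊗ D) ->
    ((C ⊗ D) ⊗ (C ⊗ D)) ⊗ (C ⊗ D)} :=
  tmap (tmid C C D D) (idl (C ⊗ D)) \o tmid (C ⊗ C) C (D ⊗ D) D.

Let mid3E t u c d :
  mid3 ((t ⊗ₜ c) ⊗ₜ (u ⊗ₜ d)) = tmid C C D D (t ⊗ₜ u) ⊗ₜ (c ⊗ₜ d).
Proof. by rewrite /= tmidE tmapE. Qed.

Let comul_mid3l (t : C ⊗ C) (u : D ⊗ D) :
  tmap tensor_comul (idl (C ⊗ D)) (tmid C C D D (t ⊗ₜ u)) =
  mid3 (tmap (comul C) (idl C) t ⊗ₜ tmap (comul D) (idl D) u).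
Proof.
move: t; apply: tensor_ind => [|t t' ht ht'|a b].
- by rewrite !(linear0, pure0l).
- by rewrite !(linearD, pureDl) ht ht'.
move: u; apply: tensor_ind => [|u u' hu hu'|c d].
- by rewrite !linear0.
- by rewrite !linearD hu hu'.
by rewrite tmidE !tmapE mid3E tensor_comulE.
Qed.

Let comul_mid3r (t : C ⊗ C) (u : D ⊗ D) :
  tassoc (C ⊗ D) (C ⊗ D) (C ⊗ D)
    (tmap (idl (C ⊗ D)) tensor_comul (tmid C C D D (t ⊗ₜ u))) =
  mid3 (tassoc C C C (tmap (idl C) (comul C) t) ⊗ₜ
        tassoc D D D (tmap (idl D) (comul D) u)).
Proof.
move: t; apply: tensor_ind => [|t t' ht ht'|a b].
- by rewrite !(linear0, pure0l).
- by rewrite !(linearD, pureDl) ht ht'.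
move: u; apply: tensor_ind => [|u u' hu hu'|c d].
- by rewrite !linear0.
- by rewrite !linearD hu hu'.
rewrite tmidE !tmapE tensor_comulE.
move: (comul C b) (comul D d) => + u; apply: tensor_ind => [|t t' ht ht'|e f].
- by rewrite !(linear0, pure0l).
- by rewrite !(linearD, pureDl) ht ht'.
move: u; apply: tensor_ind => [|u u' hu hu'|g h].
- by rewrite !linear0.
- by rewrite !linearD hu hu'.
by rewrite tmidE !tassocE mid3E tmidE.
Qed.

Lemma tensor_comulA x : tmap tensor_comul (idl (C ⊗ D)) (tensor_comul x) =
  tassoc (C ⊗ D) (C ⊗ D) (C ⊗ D)
    (tmap (idl (C ⊗ D)) tensor_comul (tensor_comul x)).
Proof.
move: x; apply: tensor_ind => [|t t' ht ht'|x y]; first by rewrite !linear0.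
  by rewrite !linearD ht ht'.
by rewrite tensor_comulE comul_mid3l comul_mid3r !comulA.
Qed.

Lemma tensor_counitl x :
  tlid (C ⊗ D) (tmap tensor_counit (idl (C ⊗ D)) (tensor_comul x)) = x.
Proof.
move: x; apply: tensor_ind => [|t t' ht ht'|x y]; first by rewrite !linear0.
  by rewrite !linearD ht ht'.
rewrite -[in RHS](counitl x) -[in RHS](counitl y) tensor_comulE.
move: (comul C x) (comul D y) => + u; apply: tensor_ind => [|t t' ht ht'|a b].
- by rewrite !(linear0, pure0l).
- by rewrite !(linearD, pureDl) ht ht'.
move: u; apply: tensor_ind => [|u u' hu hu'|c d].
- by rewrite !linear0.
- by rewrite !linearD hu hu'.
rewrite tmidE !tmapE !tlidE tensor_counitE linearZ /=.
by rewrite -[counit C a *: b]addr0 pure_linl pure0l addr0 scalerA mulrC.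
Qed.

Lemma tensor_counitr x :
  trid (C ⊗ D) (tmap (idl (C ⊗ D)) tensor_counit (tensor_comul x)) = x.
Proof.
move: x; apply: tensor_ind => [|t t' ht ht'|x y]; first by rewrite !linear0.
  by rewrite !linearD ht ht'.
rewrite -[in RHS](counitr x) -[in RHS](counitr y) tensor_comulE.
move: (comul C x) (comul D y) => + u; apply: tensor_ind => [|t t' ht ht'|a b].
- by rewrite !(linear0, pure0l).
- by rewrite !(linearD, pureDl) ht ht'.
move: u; apply: tensor_ind => [|u u' hu hu'|c d].
- by rewrite !linear0.
- by rewrite !linearD hu hu'.
rewrite tmidE !tmapE !tridE tensor_counitE linearZ /=.
by rewrite -[counit C b *: a]addr0 pure_linl pure0l addr0 scalerA mulrC.
Qed.

Definition tensor_coalgebra : coalgebra k :=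
  Coalgebra tensor_comulA tensor_counitl tensor_counitr.

End TensorCoalgebra.

End Coalgebras.

Arguments coalgebra_morphism {k} C D f.

Notation "C ⊗ᶜ D" := (tensor_coalgebra C D) (at level 40, left associativity).

Section Operations.
Context {k : fieldType} (X : coalgebra k).

(* x ⊗ y |-> m (x ⊗ y_(1)) ⊗ y_(2) *)
Definition comul_twist (m : {linear X ⊗ X -> X}) : {linear X ⊗ X -> X ⊗ X} :=
  tmap m (idl X) \o (tassoc X X X \o tmap (idl X) (comul X)).

(* lact s (x ⊗ y) is ^x y and ract s (x ⊗ y) is x^y; [trid] and [tlid] are the
   identifications X ⊗ k = X and k ⊗ X = X. *)
Definition lact (s : {linear X ⊗ X -> X ⊗ X}) : {linear X ⊗ X -> X} :=
  trid X \o (tmap (idl X) (counit X) \o s).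

Definition ract (s : {linear X ⊗ X -> X ⊗ X}) : {linear X ⊗ X -> X} :=
  tlid X \o (tmap (counit X) (idl X) \o s).

Definition G_map (s : {linear X ⊗ X -> X ⊗ X}) : {linear X ⊗ X -> X ⊗ X} :=
  comul_twist (ract s).

Definition left_nondegenerate (s : {linear X ⊗ X -> X ⊗ X}) : Prop :=
  bijective (G_map s).

Definition dot_op (s : {linear X ⊗ X -> X ⊗ X}) (hs : left_nondegenerate s) :
    {linear X ⊗ X -> X} :=
  trid X \o (tmap (idl X) (counit X) \o linv hs).

(* x ⊗ y |-> y ⊗ (x_(1) ⊗ x_(2)) |-> (y ⊗ x_(1)) ⊗ x_(2)
         |-> (y · x_(1)) ⊗ x_(2) |-> ^(y · x_(1)) x_(2) *)
Definition colon_op (s : {linear X ⊗ X -> X ⊗ X}) (hs : left_nondegenerate s) :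
    {linear X ⊗ X -> X} :=
  lact s \o (comul_twist (dot_op hs) \o tswap X X).

(* (a ⊗ b) ⊗ (c ⊗ d) |-> (c ⊗ b) ⊗ (a ⊗ d), obtained as
   (a ⊗ b) ⊗ (c ⊗ d) |-> (c ⊗ d) ⊗ (a ⊗ b) |-> (c ⊗ d) ⊗ (b ⊗ a)
   |-> (c ⊗ b) ⊗ (d ⊗ a) |-> (c ⊗ b) ⊗ (a ⊗ d). *)
Definition tperm13 : {linear (X ⊗ X) ⊗ (X ⊗ X) -> (X ⊗ X) ⊗ (X ⊗ X)} :=
  tmap (idl (X ⊗ X)) (tswap X X) \o (tmid X X X X \o
    (tmap (idl (X ⊗ X)) (tswap X X) \o tswap (X ⊗ X) (X ⊗ X))).

Lemma tperm13E a b c d :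
  tperm13 ((a ⊗ₜ b) ⊗ₜ (c ⊗ₜ d)) = (c ⊗ₜ b) ⊗ₜ (a ⊗ₜ d).
Proof. by rewrite /= tswapE tmapE /= tswapE tmidE tmapE /= tswapE. Qed.

(* x ⊗ y |-> (y_(1) : x_(2)) ⊗ (x_(1) · y_(2)), with the Sweedler components
   taken in X and not in X^cop. *)
Definition h_map (dot colon : {linear X ⊗ X -> X}) :
    {linear X ⊗ X -> X ⊗ X} :=
  tmap colon dot \o (tperm13 \o tmap (comul X) (comul X)).

Definition q_magma_coalgebra (dot colon : {linear X ⊗ X -> X}) : Prop :=
  [/\ forall x y, counit X (dot (x ⊗ₜ y)) = counit X x * counit X y,
      forall x y, counit X (colon (x ⊗ₜ y)) = counit X x * counit X y
    & coalgebra_morphism (X ⊗ᶜ cop X) (cop X ⊗ᶜ X) (h_map dot colon)].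

Definition left_regular (dot : {linear X ⊗ X -> X}) : Prop :=
  bijective (comul_twist dot).

End Operations.

(* Main.v *)
Require Import Defs.
From mathcomp Require Import all_boot all_algebra.

Local Open Scope ring_scope.

Set Implicit Arguments.
Unset Strict Implicit.
Unset Printing Implicit Defensive.

Import GRing.Theory.

(** The statement becomes transparent once all maps are read as convolutions on
the coalgebra C = X ⊗ X.  For linear maps f, g out of C write f ⋆ g for
c |-> f c_(1) ⊗ g c_(2) ([conv]).  Let p = X ⊗ ε and q = ε ⊗ X be the two
projections C -> X, and put l = p s and r = q s, i.e. l (x ⊗ y) = ^x y and
r (x ⊗ y) = x^y.  All four are coalgebra morphisms, p ⋆ q is the identity and
q ⋆ p the flip τ; composing with s gives l ⋆ r = s and r ⋆ l = τ s.  So r and l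
commute up to the flip, and so do p and q.

The map G_s is r ⋆ q, and the two operations are determined by it: by
definition G_s (c) = x ⊗ y implies x · y = p c, and colinearity of G_s over the
right factor ([comul_twist_conv]) then gives that x ⊗ y |-> x · y_(1) ⊗ y_(2)
is exactly the inverse of G_s.  This is left regularity, and it also gives
y : x = l c, by the definition of the colon operation.

As G_s is onto, everything may be tested on the elements r c_(1) ⊗ q c_(2).
The counit conditions hold because r, q, p and l preserve counits.  For h,
  h (r c_(1) ⊗ q c_(2)) = (q c_(3) : r c_(2)) ⊗ (r c_(1) · q c_(4))
                        = l c_(2) ⊗ (r c_(1) · q c_(3))
                        = l c_(1) ⊗ (r c_(2) · q c_(3)) = l c_(1) ⊗ p c_(2),
the third step exchanging r and l ([h_map_conv]).  Hence h is a coalgebra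
morphism ([h_map_morphism]): h ⊗ h, applied to the comultiplication of
X ⊗ X^cop at r c_(1) ⊗ q c_(2), gives
  h (r c_(1) ⊗ q c_(4)) ⊗ h (r c_(2) ⊗ q c_(3))
    = h (r c_(1) ⊗ q c_(4)) ⊗ l c_(2) ⊗ p c_(3)
    = h (r c_(2) ⊗ q c_(3)) ⊗ l c_(1) ⊗ p c_(4)
    = l c_(2) ⊗ p c_(3) ⊗ l c_(1) ⊗ p c_(4),
where the second step exchanges r with l and q with p, and the last expression
is the comultiplication of X^cop ⊗ X at l c_(1) ⊗ p c_(2). *)

(** * Linear maps on iterated tensor products *)

Section IteratedTensors.
Context {k : fieldType}.
Implicit Types A U V W Z : lmodType k.

Lemma pureZl V W a (v : V) (w : W) : (a *: v) ⊗ₜ w = a *: (v ⊗ₜ w).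
Proof. by rewrite -[a *: v]addr0 pure_linl pure0l addr0. Qed.

Lemma pureZr V W a (v : V) (w : W) : v ⊗ₜ (a *: w) = a *: (v ⊗ₜ w).
Proof. exact: linearZ. Qed.

Lemma tensor_ext3l U V W Z (f g : {linear (U ⊗ V) ⊗ W -> Z}) :
  (forall u v w, f (u ⊗ₜ v ⊗ₜ w) = g (u ⊗ₜ v ⊗ₜ w)) -> f =1 g.
Proof.
move=> fg; apply: tensor_ext => t w; move: t.
apply: tensor_ind => [|t t' ht ht'|u v]; last exact: fg.
  by rewrite !(linear0, pure0l).
by rewrite !(linearD, pureDl) ht ht'.
Qed.

Lemma tensor_ext3r U V W Z (f g : {linear U ⊗ (V ⊗ W) -> Z}) :
  (forall u v w, f (u ⊗ₜ (v ⊗ₜ w)) = g (u ⊗ₜ (v ⊗ₜ w))) -> f =1 g.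
Proof.
move=> fg; apply: tensor_ext => u.
apply: tensor_ind => [|t t' ht ht'|v w]; last exact: fg.
  by rewrite !linear0.
by rewrite !linearD ht ht'.
Qed.

Lemma tensor_ext22 A U V W Z (f g : {linear (A ⊗ U) ⊗ (V ⊗ W) -> Z}) :
  (forall a u v w,
     f (a ⊗ₜ u ⊗ₜ (v ⊗ₜ w)) = g (a ⊗ₜ u ⊗ₜ (v ⊗ₜ w))) -> f =1 g.
Proof.
move=> fg; apply: tensor_ext3r => t v w; move: t.
apply: tensor_ind => [|t t' ht ht'|a u]; last exact: fg.
  by rewrite !(linear0, pure0l).
by rewrite !(linearD, pureDl) ht ht'.
Qed.

Lemma tmap_id V W t : tmap (idl V) (idl W) t = t.
Proof.
move: t; apply: (@tensor_ext _ _ _ _ (tmap (idl V) (idl W)) (idl _)) => v w.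
by rewrite tmapE.
Qed.

Lemma tswapK V W t : tswap W V (tswap V W t) = t.
Proof.
move: t; apply: (@tensor_ext _ _ _ _ (tswap W V \o tswap V W) (idl _)) => v w.
by rewrite /= !tswapE.
Qed.

Lemma tmap_tswap U V W Z (f : {linear U -> V}) (g : {linear W -> Z}) t :
  tmap f g (tswap W U t) = tswap Z V (tmap g f t).
Proof.
move: t; apply: (@tensor_ext _ _ _ _ (tmap f g \o tswap W U)
  (tswap Z V \o tmap g f)) => w u.
by rewrite /= !(tmapE, tswapE).
Qed.

(** Locked, so that simplification does not expand it into the elementary
flips it is composed of; the same holds for [conv] and the projections. *)
Definition tperm213 U V W : {linear (U ⊗ V) ⊗ W -> V ⊗ (U ⊗ W)} :=
  locked (tmap (idl V) (tswap W U) \o (tswap (W ⊗ U) V \o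
    (tassoc W U V \o tswap (U ⊗ V) W)) : {linear _ -> _}).

Lemma tperm213E U V W (u : U) (v : V) (w : W) :
  tperm213 U V W (u ⊗ₜ v ⊗ₜ w) = v ⊗ₜ (u ⊗ₜ w).
Proof.
by rewrite /tperm213 -lock /= !(tswapE, tassocE, tmapE).
Qed.

Lemma tmap_tperm213 A U V W Z (f : {linear A -> V}) (g : {linear U ⊗ W -> Z}) t :
  tmap f g (tperm213 U A W t) =
  tmap (idl V) g (tperm213 U V W (tmap (tmap (idl U) f) (idl W) t)).
Proof.
move: t; apply: (@tensor_ext3l _ _ _ _ (tmap f g \o tperm213 U A W)
  (tmap (idl V) g \o
    (tperm213 U V W \o tmap (tmap (idl U) f) (idl W)))) => u a w.
by rewrite /= !(tperm213E, tmapE).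
Qed.

(** The inverse of the associator is an instance of [tperm213],
precomposed with a flip. *)
Lemma tassocK U V W t :
  tperm213 V U W (tmap (tswap U V) (idl W) (tassoc U V W t)) = t.
Proof.
move: t; apply: (@tensor_ext3r _ _ _ _ (tperm213 V U W \o
  (tmap (tswap U V) (idl W) \o tassoc U V W)) (idl _)) => u v w.
by rewrite /= tassocE tmapE tswapE tperm213E.
Qed.

Lemma tmid_tswap U V t :
  tmid U V U V (tmap (idl (U ⊗ V)) (tswap V U) t) =
  tswap (V ⊗ V) (U ⊗ U) (tmid V U V U (tmap (tswap U V) (idl (V ⊗ U)) t)).
Proof.
move: t; apply: (@tensor_ext22 _ _ _ _ _
  (tmid U V U V \o tmap (idl (U ⊗ V)) (tswap V U))
  (tswap (V ⊗ V) (U ⊗ U) \o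
    (tmid V U V U \o tmap (tswap U V) (idl (V ⊗ U))))) => a b c d.
by rewrite /= !(tmapE, idlE, tswapE, tmidE).
Qed.

Lemma tperm13_tmid (X : coalgebra k) t :
  tperm13 X t = tmap (tswap X X) (idl (X ⊗ X))
    (tmid X X X X (tmap (tswap X X) (idl (X ⊗ X)) t)).
Proof.
move: t; apply: (@tensor_ext22 _ _ _ _ _ (tperm13 X)
  (tmap (tswap X X) (idl (X ⊗ X)) \o
    (tmid X X X X \o tmap (tswap X X) (idl (X ⊗ X))))) => a b c d.
by rewrite tperm13E /= !(tmapE, tswapE, tmidE).
Qed.

End IteratedTensors.

(** * Convolution *)

Section Convolution.
Context {k : fieldType}.
Implicit Types (C X Y : coalgebra k) (A U V W Z : lmodType k).

Definition conv C V W (f : {linear C -> V}) (g : {linear C -> W}) :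
  {linear C -> V ⊗ W} := locked (tmap f g \o comul C : {linear _ -> _}).

Lemma convE C V W (f : {linear C -> V}) (g : {linear C -> W}) c :
  conv f g c = tmap f g (comul C c).
Proof. by rewrite /conv -lock. Qed.

Lemma eq_conv C V W (f f' : {linear C -> V}) (g g' : {linear C -> W}) :
  f =1 f' -> g =1 g' -> conv f g =1 conv f' g'.
Proof.
by move=> ff gg c; rewrite !convE; apply: tensor_ext => a b; rewrite !tmapE ff gg.
Qed.

Lemma tmap_conv C U V W Z (u : {linear U -> V}) (v : {linear W -> Z})
    (f : {linear C -> U}) (g : {linear C -> W}) c :
  tmap u v (conv f g c) = conv (u \o f) (v \o g) c.
Proof.
rewrite !convE; move: (comul C c).
by apply: (@tensor_ext _ _ _ _ (tmap u v \o tmap f g)) => a b /=; rewrite !tmapE.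
Qed.

(** Both sides are images of a threefold comultiplication, and the two such
comultiplications agree by coassociativity. *)
Lemma convA C U V W (f : {linear C -> U}) (g : {linear C -> V})
    (h : {linear C -> W}) c :
  tassoc U V W (conv f (conv g h) c) = conv (conv f g) h c.
Proof.
transitivity (tmap (tmap f g) h (tassoc C C C (conv (idl C) (comul C) c))).
  rewrite !convE /=; move: (comul C c).
  apply: (@tensor_ext _ _ _ _ (tassoc U V W \o tmap f (conv g h))
    (tmap (tmap f g) h \o (tassoc C C C \o tmap (idl C) (comul C)))) => a b /=.
  rewrite !tmapE convE /=; move: (comul C b).
  apply: (@tensor_ext _ _ _ _ (tassoc U V W \o (pure (f a) \o tmap g h))
    (tmap (tmap f g) h \o (tassoc C C C \o pure a))) => a' b' /=.
  by rewrite !tmapE !tassocE !tmapE.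
rewrite convE -[X in tmap (tmap _ _) _ X]comulA -convE.
rewrite [LHS](tmap_conv (tmap f g) h (comul C) (idl C)).
by apply: eq_conv => // b; rewrite convE.
Qed.

(** This is how two maps that commute up to the flip are exchanged inside a
longer Sweedler expression. *)
Lemma tperm213_conv C U V W (f : {linear C -> U}) (g : {linear C -> V})
    (h : {linear C -> W}) c :
  (forall b, conv f g b = tswap V U (conv g f b)) ->
  tperm213 U V W (conv (conv f g) h c) = conv g (conv f h) c.
Proof.
move=> fgC; rewrite -[RHS]tassocK convA tmap_conv.
by congr (tperm213 _ _ _ _); apply: eq_conv.
Qed.

(** Comultiplications of tensor coalgebras produce the left-hand side, where the
factors come in pairs; on the right the middle pair g ⋆ h is isolated, so that
an identity about g ⋆ h can be applied to it. *)
Lemma tmid_conv C A U V W (f : {linear C -> A}) (g : {linear C -> U})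
    (h : {linear C -> V}) (i : {linear C -> W}) c :
  tmid U A V W (tmap (tswap A U) (idl (V ⊗ W)) (conv (conv f g) (conv h i) c)) =
  tperm213 A (U ⊗ V) W (conv (conv f (conv g h)) i c).
Proof.
transitivity (tperm213 A (U ⊗ V) W
    (tmap (tperm213 U A V \o tmap (tswap A U) (idl V)) (idl W)
      (tassoc (A ⊗ U) V W (conv (conv f g) (conv h i) c)))).
  move: (conv _ _ _); apply: (@tensor_ext22 _ _ _ _ _ _
    (tmid U A V W \o tmap (tswap A U) (idl (V ⊗ W)))
    (tperm213 A (U ⊗ V) W \o
      (tmap (tperm213 U A V \o tmap (tswap A U) (idl V)) (idl W) \o
        tassoc (A ⊗ U) V W))) => a u v w.
  by rewrite /= !(tassocE, tmapE, idlE, tswapE, tmidE) /= tmapE tswapE !tperm213E.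
rewrite convA tmap_conv; congr (tperm213 _ _ _ _).
by apply: eq_conv => // b; rewrite /= -convA tassocK.
Qed.

(** Convolution is natural along coalgebra morphisms. *)
Lemma conv_comp C D V W (s : {linear C -> coalg_sort D})
    (f : {linear D -> V}) (g : {linear D -> W}) c :
  coalgebra_morphism C D s -> conv (f \o s) (g \o s) c = conv f g (s c).
Proof. by move=> [sD _]; rewrite [RHS]convE sD -(convE s s) tmap_conv. Qed.

Lemma coalgebra_morphism_comp C D X (s : {linear C -> coalg_sort D})
    (f : {linear D -> coalg_sort X}) :
  coalgebra_morphism C D s -> coalgebra_morphism D X f ->
  coalgebra_morphism C X (f \o s).
Proof.
move=> sM [fD fe]; split=> c /=; last by rewrite fe sM.2.
by rewrite fD -convE -(conv_comp _ _ _ sM) convE.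
Qed.

Lemma comul_morphism C X (f : {linear C -> coalg_sort X}) :
  coalgebra_morphism C X f -> comul X \o f =1 conv f f.
Proof. by move=> [fD _] c; rewrite /= fD convE. Qed.

Lemma counit_comul C c : tensor_counit C C (comul C c) = counit C c.
Proof.
rewrite -[in RHS](counitr c); move: (comul C c).
apply: (@tensor_ext _ _ _ _ (tensor_counit C C)
  (counit C \o (trid C \o tmap (idl C) (counit C)))) => a b.
by rewrite tensor_counitE /= tmapE tridE linearZ mulrC.
Qed.

Lemma counit_conv C X Y (f : {linear C -> coalg_sort X})
    (g : {linear C -> coalg_sort Y}) :
  (forall c, counit X (f c) = counit C c) ->
  (forall c, counit Y (g c) = counit C c) ->
  forall c, counit (X ⊗ᶜ Y) (conv f g c) = counit C c.
Proof.
move=> ef eg c; rewrite -[RHS]counit_comul convE; move: (comul C c).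
apply: (@tensor_ext _ _ _ _ (tensor_counit X Y \o tmap f g)
  (tensor_counit C C)) => a b.
by rewrite tensor_counitE /= tmapE -ef -eg; exact: tensor_counitE.
Qed.

(** Colinearity: f ⋆ q maps C, coacted on through q, to X ⊗ X with the coaction
of the right factor. *)
Lemma comul_twist_conv C X (m : {linear X ⊗ X -> X}) (f q : {linear C -> X}) c :
  coalgebra_morphism C X q ->
  comul_twist m (conv f q c) = conv (m \o conv f q) q c.
Proof.
move=> q_mor; rewrite /comul_twist /= tmap_conv.
have -> : conv (idl X \o f) (comul X \o q) c = conv f (conv q q) c.
  by apply: eq_conv => //; exact: comul_morphism.
by rewrite convA tmap_conv; apply: eq_conv.
Qed.

End Convolution.

(** * The map h in terms of convolution *)

(** The roles of the hypotheses: C stands for X ⊗ X, p and q for its two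
projections, l and r for the two components of s, and r ⋆ q for G_s.  Only the
relations between these maps matter for h. *)
Section Morphism.
Context {k : fieldType} (C X : coalgebra k) (dot colon : {linear X ⊗ X -> X}).
Context (l r p q : {linear C -> X}).
Hypotheses (l_mor : coalgebra_morphism C X l) (r_mor : coalgebra_morphism C X r).
Hypotheses (p_mor : coalgebra_morphism C X p) (q_mor : coalgebra_morphism C X q).
Hypothesis rlC : forall c, conv r l c = tswap X X (conv l r c).
Hypothesis pqC : forall c, conv p q c = tswap X X (conv q p c).
Hypothesis dotE : dot \o conv r q =1 p.
Hypothesis colonE : colon \o (tswap X X \o conv r q) =1 l.

(** The middle pair (r, q) is absorbed by the colon operation and becomes l;
then r and l are exchanged, and the dot operation absorbs the pair (r, q) that
is now adjacent. *)
Lemma h_map_conv c : h_map dot colon (conv r q c) = conv l p c.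
Proof.
rewrite -[LHS]/(tmap colon dot
  (tperm13 X (tmap (comul X) (comul X) (conv r q c)))) tmap_conv.
rewrite (eq_conv (comul_morphism r_mor) (comul_morphism q_mor)).
rewrite tperm13_tmid tmid_conv.
(* The colon operation acts on the isolated middle pair. *)
transitivity (tmap (idl X) dot (tperm213 X X X
    (conv (conv r (colon \o (tswap X X \o conv r q))) q c))).
  rewrite -[LHS]/((tmap colon dot \o tmap (tswap X X) (idl (X ⊗ X))) _).
  transitivity (tmap (colon \o tswap X X) dot
      (tperm213 X (X ⊗ X) X (conv (conv r (conv r q)) q c))).
    move: (tperm213 _ _ _ _); apply: (@tensor_ext _ _ _ _
      (tmap colon dot \o tmap (tswap X X) (idl (X ⊗ X)))
      (tmap (colon \o tswap X X) dot)) => u v.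
    by rewrite /= !tmapE.
  rewrite tmap_tperm213 tmap_conv; congr (tmap _ _ (tperm213 _ _ _ _)).
  by apply: eq_conv => // b; rewrite /= tmap_conv; apply: eq_conv.
rewrite (eq_conv (eq_conv (frefl r) colonE) (frefl q)) tperm213_conv //.
by rewrite tmap_conv; apply: eq_conv.
Qed.

Hypothesis conv_rq_surj : forall t, exists c, conv r q c = t.

(** Both iterated expressions are brought to the form
l c_(2) ⊗ p c_(3) ⊗ l c_(1) ⊗ p c_(4): on one side this is the compatibility with comultiplications
of l and p, on the other h is evaluated by [h_map_conv] first on the inner pair
(r, q), and, after r, l and q, p have been exchanged, on the other one. *)
Lemma h_map_morphism :
  coalgebra_morphism (X ⊗ᶜ cop X) (cop X ⊗ᶜ X) (h_map dot colon).
Proof.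
split=> t; have [c <-] := conv_rq_surj t; last first.
  rewrite h_map_conv (@counit_conv _ C (cop X) X l p l_mor.2 p_mor.2).
  by rewrite (@counit_conv _ C X (cop X) r q r_mor.2 q_mor.2).
set h := h_map dot colon.
have hE : h \o conv r q =1 conv l p by move=> b; exact: h_map_conv.
transitivity (tperm213 X (X ⊗ X) X (conv (conv l (conv l p)) p c)).
  rewrite h_map_conv -tmid_conv.
  rewrite -[LHS]/(tmid X X X X
    (tmap (tswap X X \o comul X) (comul X) (conv l p c))) !tmap_conv.
  congr (tmid _ _ _ _ _); apply: eq_conv => b /=.
    by rewrite l_mor.1 convE.
  by rewrite p_mor.1 convE.
symmetry.
rewrite -[LHS]/(tmap h h (tmid X X X X
  (tmap (comul X) (tswap X X \o comul X) (conv r q c)))).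
have -> : tmap (comul X) (tswap X X \o comul X) (conv r q c) =
    tmap (idl (X ⊗ X)) (tswap X X) (conv (conv r r) (conv q q) c).
  rewrite !tmap_conv; apply: eq_conv => b /=.
    by rewrite r_mor.1 convE.
  by rewrite q_mor.1 convE.
rewrite tmid_tswap tmid_conv tmap_tswap tmap_tperm213 tmap_conv.
(* h on the inner pair (r c_(2), q c_(3)) *)
have -> : conv (tmap (idl X) h \o conv r (conv r q)) (idl X \o q) c =
    conv (conv r (conv l p)) q c.
  by apply: eq_conv => // b; rewrite /= tmap_conv; apply: eq_conv.
(* the exchange of r with l and of p with q *)
rewrite -tmid_conv.
have -> : tmap (tswap X X) (idl (X ⊗ X)) (conv (conv r l) (conv p q) c) =
    tmap (idl (X ⊗ X)) (tswap X X) (conv (conv l r) (conv q p) c).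
  rewrite !tmap_conv; apply: eq_conv => b /=; last by rewrite pqC.
  by rewrite rlC tswapK.
(* the remaining pair (r, q) is now the inner one *)
rewrite tmid_tswap tmid_conv -tmap_tswap tswapK tmap_tperm213.
rewrite tmap_conv tmap_id; congr (tperm213 _ _ _ _).
by apply: eq_conv => // b; rewrite /= tmap_conv; apply: eq_conv.
Qed.

End Morphism.

(** * The projections of X ⊗ X *)

Section Projections.
Context {k : fieldType} (X : coalgebra k).

Definition proj_l : {linear X ⊗ X -> X} :=
  locked (trid X \o tmap (idl X) (counit X) : {linear _ -> _}).
Definition proj_r : {linear X ⊗ X -> X} :=
  locked (tlid X \o tmap (counit X) (idl X) : {linear _ -> _}).

Lemma proj_lE x y : proj_l (x ⊗ₜ y) = counit X y *: x.
Proof. by rewrite /proj_l -lock /= tmapE tridE. Qed.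

Lemma proj_rE x y : proj_r (x ⊗ₜ y) = counit X x *: y.
Proof. by rewrite /proj_r -lock /= tmapE tswapE tridE. Qed.

Lemma proj_l_comul x : proj_l (comul X x) = x.
Proof. by rewrite /proj_l -lock; exact: counitr. Qed.

Lemma proj_r_comul x : proj_r (comul X x) = x.
Proof. by rewrite /proj_r -lock; exact: counitl. Qed.

Lemma lactE (s : {linear X ⊗ X -> X ⊗ X}) t : lact s t = proj_l (s t).
Proof. by rewrite /proj_l -lock. Qed.

Lemma ractE (s : {linear X ⊗ X -> X ⊗ X}) t : ract s t = proj_r (s t).
Proof. by rewrite /proj_r -lock. Qed.

Lemma conv_tensorE (V W : lmodType k) (f : {linear X ⊗ X -> V}) (g : {linear X ⊗ X -> W}) x y :
  @conv _ (X ⊗ᶜ X) _ _ f g (x ⊗ₜ y) =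
  tmap f g (tmid X X X X (comul X x ⊗ₜ comul X y)).
Proof. by rewrite convE [comul (X ⊗ᶜ X) _]tensor_comulE. Qed.

(** The last tensor factors only contribute their counits, which recombine into
the counit of y. *)
Lemma proj_l_morphism : coalgebra_morphism (X ⊗ᶜ X) X proj_l.
Proof.
split; last first.
  apply: (@tensor_ext _ _ _ _ (counit X \o proj_l)) => x y.
  by rewrite tensor_counitE /= proj_lE linearZ /= mulrC.
move=> t; rewrite -(@convE _ (X ⊗ᶜ X)); move: t.
apply: (@tensor_ext _ _ _ _ (comul X \o proj_l)
  (@conv _ (X ⊗ᶜ X) _ _ proj_l proj_l)) => x y.
transitivity (trid _ (tmap (idl (X ⊗ X)) (tensor_counit X X)
    (comul X x ⊗ₜ comul X y))).
  by rewrite tmapE idlE tridE counit_comul /= proj_lE linearZ.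
rewrite conv_tensorE; move: (comul X x ⊗ₜ comul X y).
apply: (@tensor_ext22 _ _ _ _ _ _
  (trid _ \o tmap (idl (X ⊗ X)) (tensor_counit X X))
  (tmap proj_l proj_l \o tmid X X X X)) => a b c d.
rewrite /= tmidE !tmapE !proj_lE tridE.
by rewrite tensor_counitE pureZl pureZr scalerA mulrC.
Qed.

Lemma proj_r_morphism : coalgebra_morphism (X ⊗ᶜ X) X proj_r.
Proof.
split; last first.
  apply: (@tensor_ext _ _ _ _ (counit X \o proj_r)) => x y.
  by rewrite tensor_counitE /= proj_rE linearZ /=.
move=> t; rewrite -(@convE _ (X ⊗ᶜ X)); move: t.
apply: (@tensor_ext _ _ _ _ (comul X \o proj_r)
  (@conv _ (X ⊗ᶜ X) _ _ proj_r proj_r)) => x y.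
transitivity (tlid _ (tmap (tensor_counit X X) (idl (X ⊗ X))
    (comul X x ⊗ₜ comul X y))).
  by rewrite tmapE idlE tlidE counit_comul /= proj_rE linearZ.
rewrite conv_tensorE; move: (comul X x ⊗ₜ comul X y).
apply: (@tensor_ext22 _ _ _ _ _ _
  (tlid _ \o tmap (tensor_counit X X) (idl (X ⊗ X)))
  (tmap proj_r proj_r \o tmid X X X X)) => a b c d.
rewrite /= tmidE !tmapE !proj_rE tswapE tridE.
by rewrite tensor_counitE pureZl pureZr scalerA mulrC.
Qed.

(** Of the four Sweedler components x_(1) ⊗ y_(1) ⊗ x_(2) ⊗ y_(2), the two
projections keep x_(1) and y_(2), and the counit axioms remove the others. *)
Lemma conv_proj_lr t : @conv _ (X ⊗ᶜ X) _ _ proj_l proj_r t = t.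
Proof.
move: t; apply: (@tensor_ext _ _ _ _
  (@conv _ (X ⊗ᶜ X) _ _ proj_l proj_r) (idl _)) => x y.
rewrite conv_tensorE idlE -[in RHS](proj_l_comul x) -[in RHS](proj_r_comul y).
rewrite -[RHS]tmapE; move: (comul X x ⊗ₜ comul X y).
apply: (@tensor_ext22 _ _ _ _ _ _ (tmap proj_l proj_r \o tmid X X X X)
  (tmap proj_l proj_r)) => a b c d.
by rewrite /= tmidE !tmapE !proj_lE !proj_rE !pureZl !pureZr !scalerA mulrC.
Qed.

(** Here y_(1) and x_(2) are kept, so the factors come out in the other order. *)
Lemma conv_proj_rl t : @conv _ (X ⊗ᶜ X) _ _ proj_r proj_l t = tswap X X t.
Proof.
move: t; apply: (@tensor_ext _ _ _ _
  (@conv _ (X ⊗ᶜ X) _ _ proj_r proj_l) (tswap X X)) => x y.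
rewrite conv_tensorE -[in RHS](proj_r_comul x) -[in RHS](proj_l_comul y).
rewrite -[_ ⊗ₜ _ in RHS]tmapE; move: (comul X x ⊗ₜ comul X y).
apply: (@tensor_ext22 _ _ _ _ _ _ (tmap proj_r proj_l \o tmid X X X X)
  (tswap X X \o tmap proj_r proj_l)) => a b c d.
rewrite /= tmidE !tmapE !proj_lE !proj_rE tswapE.
by rewrite !pureZl !pureZr !scalerA mulrC.
Qed.

(** Every twist is a convolution with q; in particular G_s = r ⋆ q. *)
Lemma comul_twistE (m : {linear X ⊗ X -> X}) :
  comul_twist m =1 @conv _ (X ⊗ᶜ X) _ _ m proj_r.
Proof.
apply: (@tensor_ext _ _ _ _ (comul_twist m)
  (@conv _ (X ⊗ᶜ X) _ _ m proj_r)) => x y.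
rewrite conv_tensorE /= tmapE idlE -[x in LHS]proj_l_comul.
transitivity (tmap m (idl X) (tassoc X X X
  (tmap proj_l (idl (X ⊗ X)) (comul X x ⊗ₜ comul X y)))); first by rewrite tmapE.
move: (comul X x ⊗ₜ comul X y).
apply: (@tensor_ext22 _ _ _ _ _ _ (tmap m (idl X) \o (tassoc X X X \o
  tmap proj_l (idl (X ⊗ X)))) (tmap m proj_r \o tmid X X X X)) => a b c d.
rewrite /= tmidE !tmapE proj_lE proj_rE pureZl pureZr.
by rewrite linearZ /= tassocE linearZ /= tmapE.
Qed.

End Projections.

(** * Operations of a left non-degenerate endomorphism *)

Theorem proposition2p5 (k : fieldType) (X : coalgebra k)
    (s : {linear X ⊗ X -> X ⊗ X})
    (s_mor : coalgebra_morphism (X ⊗ᶜ X) (X ⊗ᶜ X) s)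
    (s_nd : left_nondegenerate s) :
  q_magma_coalgebra (dot_op s_nd) (colon_op s_nd) /\
  left_regular (dot_op s_nd).
Proof.
set C := X ⊗ᶜ X; set dot := dot_op s_nd; set colon := colon_op s_nd.
pose l : {linear C -> X} := proj_l X \o s.
pose r : {linear C -> X} := proj_r X \o s.
pose p : {linear C -> X} := proj_l X.
pose q : {linear C -> X} := proj_r X.
have p_mor : coalgebra_morphism C X p := proj_l_morphism X.
have q_mor : coalgebra_morphism C X q := proj_r_morphism X.
have l_mor : coalgebra_morphism C X l := coalgebra_morphism_comp s_mor p_mor.
have r_mor : coalgebra_morphism C X r := coalgebra_morphism_comp s_mor q_mor.
have rlC c : conv r l c = tswap X X (conv l r c).
  by rewrite !(conv_comp _ _ _ s_mor) conv_proj_rl conv_proj_lr.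
have pqC c : conv p q c = tswap X X (conv q p c).
  by rewrite conv_proj_rl tswapK conv_proj_lr.
have GE : G_map s =1 conv r q.
  move=> c; rewrite [LHS]comul_twistE; apply: eq_conv => // b.
  exact: ractE.
have dotG c : dot (conv r q c) = p c.
  by rewrite -GE /dot /dot_op /= linvK' /p /proj_l -lock.
have twistG c : comul_twist dot (conv r q c) = c.
  rewrite (comul_twist_conv _ _ _ q_mor) -[RHS]conv_proj_lr.
  exact: eq_conv.
have colonG c : colon (tswap X X (conv r q c)) = l c.
  rewrite -[LHS]/(lact s (comul_twist dot (tswap X X (tswap X X _)))).
  by rewrite tswapK twistG lactE.
have G_surj t : exists c, conv r q c = t.
  by exists (linv s_nd t); rewrite -GE linvK.
have counitG c : counit C (conv r q c) = counit C c.
  exact: counit_conv r_mor.2 q_mor.2 c.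
split; last first.
  exists (conv r q) => c; last exact: twistG.
  by have [b <-] := G_surj c; rewrite twistG.
split=> [x y|x y|].
- rewrite -tensor_counitE; have [c <-] := G_surj (x ⊗ₜ y).
  by rewrite dotG p_mor.2 [RHS]counitG.
- rewrite mulrC -tensor_counitE -tswapE; have [c <-] := G_surj (y ⊗ₜ x).
  by rewrite colonG l_mor.2 [RHS]counitG.
exact: h_map_morphism l_mor r_mor p_mor q_mor rlC pqC dotG colonG G_surj.
Qed.
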